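(* Let $K$ be an algebraically closed field of characteristic $p>0$, and let $\mathbb F_p\subset K$ denote the prime field. Let $a\in K\setminus\mathbb F_p$ and $b\in K$, $b\ne0$, let $L_2$ be the line in $\mathbb P^3_K$ corresponding to $M_2=\begin{pmatrix}a&b\\0&a\end{pmatrix}$, and let $\mathcal L=\{L_\infty,L_0,L_1,L_2\}$. Then $G_{\mathcal L}$ is abelian of order $p^2$ and is isomorphic to $\mathbb F_p\times\mathbb F_p\cong C_p\times C_p$, where $C_p$ is the cyclic group of order $p$.
   Context: $\mathbb P^3=\mathbb P(K^2\oplus K^2)$. $L_0=\{(v,0)\}$, $L_\infty=\{(0,v)\}$, and the line corresponding to a matrix $M\in\mathrm{GL}_2(K)$ is $\{(v,Mv)\mid v\in K^2\}$; $L_1$ corresponds to $M_1=I$. For three distinct pairwise skew (i.e. disjoint) lines $L_i,L_j,L_k$, the map $f_{ijk}:L_i\to L_j$ sends $p\in L_i$ to the unique intersection point of $L_j$ with the plane spanned by $p$ and $L_k$. For a finite set $\mathcal L$ of at least three pairwise skew lines, $C_{\mathcal L}$ is the groupoid whose objects are the lines of $\mathcal L$ and whose arrows are the maps $f_{ijk}$ (with $L_i,L_j,L_k\in\mathcal L$ distinct) together with all their possible compositions; the groups $\mathrm{Hom}_{C_{\mathcal L}}(L_i,L_i)\subseteq\mathrm{Aut}(L_i)\cong\mathrm{PGL}_2(K)$ are all isomorphic, and $G_{\mathcal L}$ denotes this common group. *)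

(* Defs.v *)
From HB Require Import structures.
From mathcomp Require Import all_boot all_order all_algebra all_fingroup all_solvable.
From mathcomp Require Import finmap boolp classical_sets functions cardinality.

Set Implicit Arguments.
Unset Strict Implicit.
Unset Printing Implicit Defensive.

Import GRing.Theory.
Local Open Scope ring_scope.
Local Open Scope fset_scope.

(* P^3 = P(K^2 (+) K^2): its points and lines are the subspaces of
   K^2 (+) K^2 of dimension 1 and 2. *)
Notation K2K2 K := ('cV[K]_2 * 'cV[K]_2)%type.

Record line (K : fieldType) := Line {
  line_vs :> {vspace K2K2 K};
  line_dim : \dim line_vs == 2
}.

HB.instance Definition _ (K : fieldType) := [isSub for @line_vs K].
HB.instance Definition _ (K : fieldType) := [Choice of line K by <:].

Record point (K : fieldType) (L : line K) := Point {
  point_vs :> {vspace K2K2 K};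
  pointP : (\dim point_vs == 1) && (point_vs <= L)%VS
}.

HB.instance Definition _ (K : fieldType) (L : line K) :=
  [isSub for @point_vs K L].
HB.instance Definition _ (K : fieldType) (L : line K) :=
  [Choice of point L by <:].

Section Lines.
Variable K : fieldType.
Implicit Types (A B M : 'M[K]_2) (L : line K).

Definition param_fun A B (v : 'cV[K]_2) : K2K2 K := (A *m v, B *m v).

Fact param_fun_linear A B : linear (param_fun A B).
Proof. by move=> c u v; rewrite /param_fun !mulmxDr -!scalemxAr. Qed.

HB.instance Definition _ A B :=
  GRing.isLinear.Build K 'cV[K]_2 (K2K2 K) *:%R (param_fun A B)
    (param_fun_linear A B).

Definition param A B : {vspace K2K2 K} := limg (linfun (param_fun A B)).

Lemma memv_param A B (x : K2K2 K) :
  reflect (exists v, x = (A *m v, B *m v)) (x \in param A B).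
Proof.
apply: (iffP memv_imgP) => [[v _ ->]|[v ->]]; exists v; rewrite ?lfunE //.
exact: memvf.
Qed.

Fact dim_param A B : (A == 1%:M) || (B == 1%:M) -> \dim (param A B) == 2.
Proof.
move=> AB; rewrite limg_dim_eq ?dimvf ?/dim /= ?muln1 //.
apply/eqP; rewrite capfv -subv0; apply/subvP => v.
rewrite memv_ker lfunE /= memv0 => /eqP[Av Bv].
case/orP: AB => /eqP E; first by rewrite -Av E mul1mx.
by rewrite -Bv E mul1mx.
Qed.

Definition graph_line M : line K :=
  Line (@dim_param 1%:M M (introT orP (or_introl (eqxx _)))).
Definition L_0 : line K :=
  Line (@dim_param 1%:M 0 (introT orP (or_introl (eqxx _)))).
Definition L_oo : line K :=
  Line (@dim_param 0 1%:M (introT orP (or_intror (eqxx _)))).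

Lemma mem_graph_line M x : (x \in line_vs (graph_line M)) = (x.2 == M *m x.1).
Proof.
apply/memv_param/eqP => [[v ->]|xM]; first by rewrite /= mul1mx.
by exists x.1; rewrite mul1mx -xM -surjective_pairing.
Qed.

Lemma mem_L_0 x : (x \in line_vs L_0) = (x.2 == 0).
Proof. by rewrite (mem_graph_line 0) mul0mx. Qed.

Lemma mem_L_oo x : (x \in line_vs L_oo) = (x.1 == 0).
Proof.
apply/memv_param/eqP => [[v ->]|x0]; first by rewrite /= mul0mx.
by exists x.2; rewrite mul0mx mul1mx -x0 -surjective_pairing.
Qed.

Fact dim_K2K2 : \dim {:K2K2 K} = 4.
Proof. by rewrite dimvf /dim /= /dim /= !muln1. Qed.

Definition skew (L M : line K) : bool := (L :&: M == 0)%VS.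

Lemma skewC L1 L2 : skew L1 L2 = skew L2 L1.
Proof. by rewrite /skew capvC. Qed.

Lemma skewP L1 L2 :
  reflect (forall x, x \in line_vs L1 -> x \in line_vs L2 -> x = 0)
          (skew L1 L2).
Proof.
rewrite /skew -subv0; apply: (iffP subvP) => H x.
  by move=> x1 x2; apply/eqP; rewrite -memv0 H // memv_cap x1.
by rewrite memv_cap memv0 => /andP[x1 x2]; apply/eqP/H.
Qed.

Lemma point_dim L (P : point L) : \dim P = 1.
Proof. by case/andP: (pointP P) => /eqP. Qed.

Lemma point_sub L (P : point L) : (P <= L)%VS.
Proof. by case/andP: (pointP P). Qed.

Lemma point_inj L (P Q : point L) : point_vs P = point_vs Q -> P = Q.
Proof. exact: val_inj. Qed.

Lemma point_le L (P Q : point L) : (P <= Q)%VS -> P = Q.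
Proof.
by move=> PQ; apply/point_inj/eqP; rewrite eqEdim PQ !point_dim.
Qed.

Lemma dim_plane L (Lk : line K) (P : point L) :
  skew L Lk -> \dim (P + Lk) = 3.
Proof.
move=> /eqP LLk; rewrite dimv_disjoint_sum ?point_dim ?(eqP (line_dim Lk)) //.
by apply/eqP; rewrite -subv0 -LLk capvS // point_sub.
Qed.

Fact proj_subproof (Li Lj Lk : line K) (P : point Li) :
    skew Li Lk -> skew Lj Lk ->
  (\dim (Lj :&: (P + Lk)) == 1) && (Lj :&: (P + Lk) <= Lj)%VS.
Proof.
move=> sik sjk; rewrite capvSl andbT.
have := dimv_sum_cap Lj (P + Lk).
rewrite (dim_plane P sik) (eqP (line_dim Lj)).
suff -> : (Lj + (P + Lk))%VS = fullv.
  by rewrite dim_K2K2 => /eqP; rewrite (eqn_add2l 4 _ 1).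
apply/eqP; rewrite eqEdim subvf dim_K2K2.
have <- : \dim (Lj + Lk) = 4.
  by rewrite (dimv_disjoint_sum (eqP sjk)) !(eqP (line_dim _)).
by rewrite dimvS // addvS ?addvSr.
Qed.

(* f_ijk : P |-> the point where L_j meets the plane <P, L_k> *)
Definition proj (Li Lj Lk : line K) (sik : skew Li Lk) (sjk : skew Lj Lk)
    (P : point Li) : point Lj :=
  Point (proj_subproof P sik sjk).

Lemma projK (Li Lj Lk : line K) (sik : skew Li Lk) (sjk : skew Lj Lk) :
  cancel (proj sik sjk) (proj sjk sik).
Proof.
move=> P; apply/esym/point_le; rewrite subv_cap point_sub /=.
set Q := (Lj :&: _)%VS; suff /eqP -> : (Q + Lk == P + Lk)%VS by exact: addvSl.
rewrite eqEdim (dim_plane P sik) (dim_plane (proj sik sjk P) sjk) leqnn andbT.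
by rewrite subv_add capvSr addvSr.
Qed.

End Lines.

Record skew_lines (K : fieldType) := SkewLines {
  lines :> {fset line K};
  lines_ge3 : (3 <= #|` lines|)%N;
  lines_skew : {in lines &, forall L M, L != M -> skew L M}
}.

Section Groupoid.
Variables (K : fieldType) (LL : skew_lines K).
Implicit Types i j k : LL.

Lemma skew_of i j : i != j -> skew (fsval i) (fsval j).
Proof. exact: (lines_skew (fsvalP i) (fsvalP j)). Qed.

Inductive arrow : forall i j, (point (fsval i) -> point (fsval j)) -> Prop :=
| arrow_proj i j k (ij : i != j) (ik : i != k) (jk : j != k) :
    arrow (proj (skew_of ik) (skew_of jk))
| arrow_id i : @arrow i i id
| arrow_comp i j k f g :
    @arrow i j f -> @arrow j k g -> arrow (g \o f).

Lemma arrow_inv i j f :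
  @arrow i j f -> exists2 g, @arrow j i g & cancel f g /\ cancel g f.
Proof.
elim=> {i j f} [i j k ij ik jk|i
               |i j k f g _ [f' af' [fK f'K]] _ [g' ag' [gK g'K]]].
- exists (proj (skew_of jk) (skew_of ik)); last by split; apply: projK.
  by apply: arrow_proj; rewrite eq_sym.
- by exists id => //; apply: arrow_id.
- by exists (f' \o g'); [apply: arrow_comp ag' af' | split; apply: can_comp].
Qed.

(* Hom(L_i, L_i), under composition *)
Record vertex_group i := VertexGroup {
  vg_fun :> point (fsval i) -> point (fsval i);
  vg_arrow : `[< arrow vg_fun >]
}.

Section VertexGroup.
Variable i : LL.

HB.instance Definition _ := [isSub for @vg_fun i].
HB.instance Definition _ := [Choice of vertex_group i by <:].

Implicit Types f g : vertex_group i.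

Lemma vgP f g : vg_fun f = vg_fun g -> f = g.
Proof. exact: val_inj. Qed.

Definition vone : vertex_group i := VertexGroup (asboolT (arrow_id i)).

Definition vmul f g : vertex_group i :=
  VertexGroup
    (asboolT (arrow_comp (asboolW (vg_arrow g)) (asboolW (vg_arrow f)))).

Fact vinv_subproof f :
  exists g : vertex_group i, cancel f g /\ cancel g f.
Proof.
have [g ag fgK] := arrow_inv (asboolW (vg_arrow f)).
by exists (VertexGroup (asboolT ag)).
Qed.

Definition vinv f : vertex_group i := sval (cid (vinv_subproof f)).

Fact vmulA : associative vmul. Proof. by move=> f g h; apply/vgP. Qed.
Fact vmul1 : left_id vone vmul. Proof. by move=> f; apply/vgP. Qed.
Fact vmulr1 : right_id vone vmul. Proof. by move=> f; apply/vgP. Qed.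
Fact vmulV : left_inverse vone vinv vmul.
Proof.
move=> f; apply/vgP/funext => P.
exact: (svalP (cid (vinv_subproof f))).1.
Qed.
Fact vmulrV : right_inverse vone vinv vmul.
Proof.
move=> f; apply/vgP/funext => P.
exact: (svalP (cid (vinv_subproof f))).2.
Qed.

HB.instance Definition _ := isGroup.Build (vertex_group i)
  vmulA vmul1 vmulr1 vmulV vmulrV.
End VertexGroup.
End Groupoid.

(* Pitfall: the groupType law carried by 'F_p is addition, so that
   'F_p * 'F_p is a groupType for componentwise addition. *)
Definition group_iso (G H : groupType) : Prop :=
  exists f : {multiplicative G -> H}, bijective f.

Lemma fset4_ge3 (T : choiceType) (x y z w : T) :
  x != y -> x != z -> z != y -> (3 <= #|` [fset x; y; z; w]|)%N.
Proof.
move=> xy xz zy.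
have /fsubset_leq_card : x |` [fset y; z] `<=` [fset x; y; z; w].
  by apply/fsubsetP => u; rewrite !inE -!orbA => /or3P[] ->; rewrite ?orbT.
by rewrite cardfsU1 cardfs2 !inE negb_or xy xz (eq_sym y) zy.
Qed.

Lemma fset4_pairwise (T : choiceType) (r : rel T) (x y z w : T) :
    symmetric r ->
    r x y -> r x z -> r x w -> r z y -> r w y -> r w z ->
  {in [fset x; y; z; w] &, forall u v, u != v -> r u v}.
Proof.
move=> rC xy xz xw zy wy wz u v; rewrite !inE -!orbA.
by move=> /or4P[] /eqP-> /or4P[] /eqP-> ne;
  rewrite ?eqxx // in ne *; rewrite // rC.
Qed.

Section FourLines.
Variables (K : fieldType) (a b : K).

Definition M_2 : 'M[K]_2 := block_mx a%:M b%:M 0 a%:M : 'M_(1 + 1).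

Definition four_lines : {fset line K} :=
  [fset L_oo K; L_0 K; graph_line 1%:M; graph_line M_2].

Lemma skew_graph (M N : 'M[K]_2) :
  M - N \in unitmx -> skew (graph_line M) (graph_line N).
Proof.
move=> uMN; apply/skewP => x; rewrite !mem_graph_line => /eqP xM /eqP xN.
have x1 : x.1 = 0.
  have /(congr1 (mulmx (invmx (M - N)))) : (M - N) *m x.1 = 0.
    by rewrite mulmxBl -xM -xN subrr.
  by rewrite mulKmx // mulmx0.
by rewrite [x]surjective_pairing xM x1 mulmx0.
Qed.

Lemma graph_line0 : graph_line 0 = L_0 K. Proof. exact: val_inj. Qed.

Lemma skew_oo M : skew (L_oo K) (graph_line M).
Proof.
apply/skewP => x; rewrite mem_graph_line mem_L_oo => /eqP x1 /eqP x2.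
by rewrite [x]surjective_pairing x2 x1 mulmx0.
Qed.

Lemma skew_neq (L M : line K) : skew L M -> L != M.
Proof.
apply: contraTneq => <-; rewrite /skew capvv.
by rewrite -dimv_eq0 (eqP (line_dim L)).
Qed.

Lemma unit_tri (c d : K) :
  c != 0 -> (block_mx c%:M d%:M 0 c%:M : 'M_(1 + 1)) \in unitmx.
Proof.
by move=> c0; rewrite unitmxE det_ublock !det_scalar !expr1 unitfE mulf_neq0.
Qed.

Lemma M_2B1 :
  M_2 - 1%:M = block_mx (a - 1)%:M b%:M 0 (a - 1)%:M :> 'M_(1 + 1).
Proof.
rewrite (@scalar_mx_block _ 1 1); set N := block_mx 1%:M _ _ _.
change (M_2 - N) with (block_mx a%:M b%:M 0 a%:M - N : 'M_(1 + 1)).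
by rewrite opp_block_mx add_block_mx !oppr0 !addr0 -raddfB.
Qed.

Lemma four_linesP (a0 : a != 0) (a1 : a != 1) :
  (3 <= #|` four_lines|)%N /\
  {in four_lines &, forall L M, L != M -> skew L M}.
Proof.
have s10 : skew (graph_line (1%:M : 'M[K]_2)) (L_0 K).
  by apply: (skew_graph (N := 0)); rewrite subr0 unitmx1.
have s20 : skew (graph_line M_2) (L_0 K).
  by apply: (skew_graph (N := 0)); rewrite subr0 unit_tri.
have s21 : skew (graph_line M_2) (graph_line 1%:M).
  by apply: skew_graph; rewrite M_2B1 unit_tri // subr_eq0.
have so M : skew (L_oo K) (graph_line M) by exact: skew_oo.
have so0 : skew (L_oo K) (L_0 K) by exact: so.
split.
  exact: fset4_ge3 (skew_neq so0) (skew_neq (so _)) (skew_neq s10).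
exact: (fset4_pairwise (@skewC K) so0 (so _) (so _) s10 s20 s21).
Qed.

(* c%:R, for c : 'F_p, is the image of c in K when K has characteristic p. *)
Definition notin_prime_field p := forall c : 'F_p, a != c%:R.

Lemma notin_prime_field_neq p : notin_prime_field p -> a != 0 /\ a != 1.
Proof. by move=> aFp; split; [exact: (aFp 0) | exact: (aFp 1)]. Qed.

Definition four_skew_lines p (aFp : notin_prime_field p) : skew_lines K :=
  let a01 := notin_prime_field_neq aFp in
  let LP := four_linesP (proj1 a01) (proj2 a01) in
  SkewLines (proj1 LP) (proj2 LP).
End FourLines.

(* Main.v *)
Require Import Defs.
From HB Require Import structures.
From mathcomp Require Import all_boot all_order all_algebra all_fingroup all_solvable.
From mathcomp Require Import finmap boolp classical_sets functions cardinality.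
From mathcomp Require Import ring.

(* All the matrices involved lie in the commutative ring K[E], E ^ 2 = 0, of
   matrices x + y E. In the coordinates v |-> (v, M v) on the line of M and
   v |-> (0, v) on L_oo, the map f_ijk is v |-> (M_j - M_k)^-1 (M_i - M_k) v,
   with the factors involving L_oo dropped. Up to scalars, x + y E is the shear
   1 + (y / x) E, and shears compose by adding y / x, so an arrow is a
   translation of the affine line K. The differences of the matrices 0, 1 and
   a + b E contribute only 0, b / a and b / (a - 1), and arrows realise these
   two translations as loops; so the vertex groups are the additive group
   F_p b / a + F_p b / (a - 1). The sum is direct since a is not in F_p. *)

Set Implicit Arguments.
Unset Strict Implicit.
Unset Printing Implicit Defensive.

Import GRing.Theory.
Local Open Scope ring_scope.

(** * Isomorphisms of groups given by relations, and products of cyclic groups *)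

Section GroupIso.

Lemma group_iso_trans (G H L : groupType) :
  group_iso G H -> group_iso H L -> group_iso G L.
Proof.
move=> [f bf] [g bg]; exists (g \o f : {multiplicative G -> L}).
exact: bij_comp bg bf.
Qed.

(** Choice turns a relation that is total and single-valued both ways into a bijection. The relation
    form suits arrows, whose shear is only known to exist. *)
Lemma group_iso_of_rel (G H : groupType) (R : G -> H -> Prop) :
    (forall f, exists x, R f x) -> (forall x, exists f, R f x) ->
    (forall f x y, R f x -> R f y -> x = y) ->
    (forall f g x, R f x -> R g x -> f = g) ->
    (forall f g x y, R f x -> R g y -> R (f * g)%g (x * y)%g) ->
  group_iso G H.
Proof.
move=> totl totr inj1 inj2 mulR.
pose phi f := sval (cid (totl f)).
have phiP f : R f (phi f) := svalP (cid (totl f)).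
have phiM : {morph phi : f g / (f * g)%g}.
  by move=> f g; apply: inj1 (phiP _) (mulR _ _ _ _ (phiP f) (phiP g)).
pose Phi := HB.pack_for {multiplicative G -> H} phi
  (isMultiplicative.Build G H phi phiM).
exists Phi; pose psi x := sval (cid (totr x)).
have psiP x : R (psi x) x := svalP (cid (totr x)).
exists psi => z; first exact: inj2 (psiP _) (phiP z).
exact: inj1 (phiP _) (psiP z).
Qed.

(** With [g] a generator of [C], the isomorphism is x |-> g ^ x in each component. *)
Lemma group_iso_Fp2_cyclic (p : nat) (C : finGroupType) :
    prime p -> cyclic [set: C] -> #|C| = p ->
  group_iso ('F_p * 'F_p)%type (C * C)%type.
Proof.
move=> p_pr /cyclicP[g gC] cardC.
have og : #[g]%g = p by rewrite /order -gC cardsT.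
have vFp (x : 'F_p) : (x < p)%N.
  by rewrite -[p in (_ < p)%N](Fp_cast p_pr) ltn_ord.
have mulg (x y : 'F_p) : (g ^+ (x * y)%g = g ^+ x * g ^+ y)%g.
  (* The group law of ['F_p] is addition modulo a bound that [Fp_cast] identifies with [p]. *)
  have -> : nat_of_ord (x * y)%g = ((x + y) %% #[g]%g)%N.
    by rewrite og; exact: (congr1 (modn (x + y)) (Fp_cast p_pr)).
  by rewrite expg_mod_order expgD.
have injg (x y : 'F_p) : (g ^+ x = g ^+ y)%g -> x = y.
  by move/eqP; rewrite eq_expg_mod_order og !modn_small // => /eqP/val_inj.
have surjg (c : C) : exists x : 'F_p, (g ^+ x)%g = c.
  have /cyclePmin[n] : c \in <[g]>%g by rewrite -gC inE.
  rewrite og => np ->; exists n%:R.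
  by rewrite val_Fp_nat // modn_small.
apply: (@group_iso_of_rel _ _
  (fun (x : 'F_p * 'F_p) (c : C * C) =>
     (g ^+ x.1 = c.1)%g /\ (g ^+ x.2 = c.2)%g)).
- by move=> x; exists (g ^+ x.1, g ^+ x.2)%g.
- move=> [c d]; have [x xc] := surjg c; have [y yd] := surjg d.
  by exists (x, y).
- by move=> x [c1 c2] [d1 d2] /= [-> ->] [-> ->].
- by move=> [x1 x2] [y1 y2] c /= [<- <-] [/injg-> /injg->].
- move=> [x1 x2] [y1 y2] [c1 c2] [d1 d2] /= [<- <-] [<- <-].
  by split; apply: mulg.
Qed.

End GroupIso.

(** * The embedding of F_p in a field of characteristic p *)

Section PrimeField.
Variables (R : fieldType) (p : nat).
Hypothesis charR : p \in [pchar R].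
Let p_pr : prime p := pcharf_prime charR.

Lemma Fp_natr n : ((n%:R : 'F_p) : nat)%:R = n%:R :> R.
Proof. by rewrite val_Fp_nat // GRing.natr_mod_pchar. Qed.

Lemma Fp_natrD (x y : 'F_p) : (x + y : 'F_p)%R%:R = x%:R + y%:R :> R.
Proof.
have -> : x + y = (nat_of_ord x + nat_of_ord y)%:R :> 'F_p.
  by rewrite natrD !natr_Zp.
by rewrite Fp_natr natrD.
Qed.

Lemma Fp_natrM (x y : 'F_p) : (x * y : 'F_p)%R%:R = x%:R * y%:R :> R.
Proof.
have -> : x * y = (nat_of_ord x * nat_of_ord y)%:R :> 'F_p.
  by rewrite natrM !natr_Zp.
by rewrite Fp_natr natrM.
Qed.

Lemma Fp_natr_eq0 (x : 'F_p) : (x%:R == 0 :> R) = (x == 0).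
Proof.
apply/idP/eqP => [|-> //]; rewrite -(dvdn_pcharf charR) => px.
apply/val_inj/eqP; have [//|x0] := posnP x.
have := dvdn_leq x0 px; rewrite leqNgt -[p in (_ < p)%N](Fp_cast p_pr).
by rewrite ltn_ord.
Qed.

Lemma Fp_natrV (x : 'F_p) : (x^-1 : 'F_p)%R%:R = x%:R^-1 :> R.
Proof.
have [->|x0] := eqVneq x 0; first by rewrite !invr0.
have x0' : x%:R != 0 :> R by rewrite Fp_natr_eq0.
by apply: (mulIf x0'); rewrite -Fp_natrM !mulVf.
Qed.

End PrimeField.

(** * Matrices x + y E, coordinates on lines, and projections in coordinates *)

Section Tri.
Variable K : fieldType.

Definition tri (x y : K) : 'M[K]_2 :=
  \matrix_(i, j) (x *+ (i == j) + y *+ (i < j)%N).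

Lemma tri_mul x y z w v :
  tri x y *m (tri z w *m v) = tri (x * z) (x * w + y * z) *m v :> 'cV_2.
Proof.
rewrite mulmxA; congr (_ *m _); apply/matrixP => i j.
rewrite !mxE !big_ord_recl big_ord0 !mxE.
by case: i j => [[|[|m]] ?] [[|[|n]] ?] //; rewrite -?val_eqE /=; ring.
Qed.

Lemma tri_add x y z w (v : 'cV_2) :
  tri x y *m v + tri z w *m v = tri (x + z) (y + w) *m v.
Proof.
rewrite -mulmxDl; congr (_ *m _); apply/matrixP => i j.
by rewrite !mxE !mulrnDl addrACA.
Qed.

Lemma tri_scalar c : tri c 0 = c%:M.
Proof. by apply/matrixP => i j; rewrite !mxE mul0rn addr0. Qed.

Lemma scale_tri c x y (v : 'cV_2) :
  c *: (tri x y *m v) = tri (c * x) (c * y) *m v.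
Proof. by rewrite -mul_scalar_mx -tri_scalar tri_mul mul0r addr0. Qed.

Lemma M_2_tri a b : M_2 a b = tri a b.
Proof.
apply/matrixP => i j; rewrite !mxE.
case: splitP => k ek; rewrite !mxE; case: splitP => l el;
  move: ek el; rewrite (ord1 k) (ord1 l) !mxE /=;
  by rewrite -?val_eqE /= => -> -> /=;
  rewrite ?(addn0, eqxx) /= ?mulr1n ?mulr0n ?addr0 ?add0r.
Qed.

(* A triple (c, x, y) stands for the line {(c v, tri x y v)}, where c = 1, or
   c = 0 and (x, y) = (1, 0). *)
Implicit Types q r : K * K * K.

Definition frame_pt q : 'cV[K]_2 -> K2K2 K :=
  param_fun (tri q.1.1 0) (tri q.1.2 q.2).

Fact frame_pt_linear q : linear (frame_pt q).
Proof. exact: param_fun_linear. Qed.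

HB.instance Definition _ q :=
  GRing.isLinear.Build K 'cV[K]_2 (K2K2 K) *:%R (frame_pt q)
    (frame_pt_linear q).

(** The equation holds at all (c v, tri x y v) because [tri] matrices commute; for (0, 1, 0) it
    reads z.1 = 0. *)
Definition frames q (L : line K) : Prop :=
  (q.1.1 = 1 \/ q = (0, 1, 0)) /\
  forall z, (z \in line_vs L) = (tri q.1.2 q.2 *m z.1 == tri q.1.1 0 *m z.2).

Lemma frames_oo : frames (0, 1, 0) (L_oo K).
Proof.
split; first by right.
by move=> z; rewrite mem_L_oo !tri_scalar mul1mx mul_scalar_mx scale0r.
Qed.

Lemma frames_graph x y : frames (1, x, y) (graph_line (tri x y)).
Proof.
split; first by left.
by move=> z; rewrite mem_graph_line tri_scalar mul1mx eq_sym.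
Qed.

Section Frame.
Variables (q : K * K * K) (L : line K).
Hypothesis qL : frames q L.

Lemma frame_pt_mem v : frame_pt q v \in line_vs L.
Proof.
by rewrite qL.2 /= !tri_mul !mulr0 !mul0r addr0 add0r mulrC (mulrC q.2).
Qed.

Lemma frame_pt_onto z : z \in line_vs L -> exists v, z = frame_pt q v.
Proof.
rewrite qL.2 => /eqP zL; case: qL.1 zL => [c1 | ->] /=; last first.
  rewrite !tri_scalar mul1mx mul_scalar_mx scale0r => z1; exists z.2.
  rewrite /frame_pt /param_fun /= !tri_scalar mul1mx mul_scalar_mx scale0r -z1.
  exact: surjective_pairing.
rewrite c1 tri_scalar mul1mx => z2; exists z.1.
rewrite /frame_pt /param_fun /= c1 tri_scalar mul1mx z2.
exact: surjective_pairing.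
Qed.

Lemma frame_pt_eq0 v : frame_pt q v = 0 -> v = 0.
Proof.
case: qL.1 => [c1 | ->] [].
  by rewrite c1 tri_scalar mul1mx.
by rewrite !tri_scalar mul1mx.
Qed.

Lemma frame_pt_in_point (P : Defs.point L) :
  exists2 v, v != 0 & frame_pt q v \in point_vs P.
Proof.
have P0 : point_vs P != 0%VS by rewrite -dimv_eq0 point_dim.
have [v Pv] := frame_pt_onto (subvP (point_sub P) _ (memv_pick P)).
exists v; last by rewrite -Pv memv_pick.
apply: contraNneq P0 => v0; rewrite -vpick0 Pv v0.
by rewrite linear0.
Qed.

Lemma point_of_frame v :
  v != 0 -> exists P : Defs.point L, frame_pt q v \in point_vs P.
Proof.
move=> v0.
have dimP : (\dim <[frame_pt q v]> == 1%N) && (<[frame_pt q v]> <= L)%VS.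
  rewrite dim_vline -memvE frame_pt_mem andbT.
  by rewrite (contra_neq (@frame_pt_eq0 v) v0).
by exists (Point dimP); apply: memv_line.
Qed.

End Frame.

Lemma point_vline (L : line K) (P : Defs.point L) z :
  z \in point_vs P -> z != 0 -> point_vs P = <[z]>%VS.
Proof.
move=> Pz z0; apply/esym/eqP.
by rewrite eqEdim -memvE Pz point_dim dim_vline z0.
Qed.

(* [tri (cross q r) (crossE q r)] is the matrix of the line of [r] minus that
   of [q], made homogeneous so as to allow [L_oo]. *)
Definition cross q r : K := r.1.2 * q.1.1 - r.1.1 * q.1.2.
Definition crossE q r : K := r.2 * q.1.1 - r.1.1 * q.2.
Definition slope q r : K := crossE q r / cross q r.

(** The equation of [Lk] sends [frame_pt q v] to [cross q qk] times the shear of [v] by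
    [slope q qk]. After division by the [cross] factors, the vectors on [Li] and [Lj] get the same
    value, so their difference lies in [Lk] and the vector on [Lj] lies in the plane of [P] and
    [Lk]. *)
Lemma proj_frame (Li Lj Lk : line K) (qi qj qk : K * K * K)
    (sik : Defs.skew Li Lk) (sjk : Defs.skew Lj Lk) (P : Defs.point Li) v :
    frames qj Lj -> frames qk Lk ->
    cross qi qk != 0 -> cross qj qk != 0 ->
    frame_pt qi v \in point_vs P ->
  frame_pt qj (tri 1 (slope qi qk - slope qj qk) *m v)
    \in point_vs (proj sik sjk P).
Proof.
move=> fj fk dik djk Pv; rewrite memv_cap (frame_pt_mem fj) /=.
set u := tri _ _ *m v.
have Lkw : (cross qj qk)^-1 *: frame_pt qj u
             - (cross qi qk)^-1 *: frame_pt qi v \in line_vs Lk.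
  rewrite fk.2 -scaleNr /frame_pt /param_fun /u /=.
  rewrite !(tri_mul, scale_tri, tri_add); apply/eqP.
  move: dik djk; rewrite /slope /crossE /cross => dik djk.
  by congr (tri _ _ *m _); field; rewrite dik djk.
rewrite addvC -[frame_pt qj u](scalerKV djk); apply: memvZ.
rewrite -[X in X \in _](subrK ((cross qi qk)^-1 *: frame_pt qi v)).
by apply: memv_add => //; apply: memvZ.
Qed.

End Tri.

(** * The four lines: every arrow is a shear by a translation *)

Lemma in_fset4P (T : choiceType) (x y z w u : T) :
  u \in [fset x; y; z; w]%fset -> [\/ u = x, u = y, u = z | u = w].
Proof.
by rewrite !inE -!orbA => /or4P[] /eqP->;
  [apply: Or41 | apply: Or42 | apply: Or43 | apply: Or44].
Qed.

Lemma mem_fset4 (T : choiceType) (x y z w : T) (A := [fset x; y; z; w]%fset) :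
  [/\ x \in A, y \in A, z \in A & w \in A].
Proof. by rewrite !inE !eqxx !orbT. Qed.

Section VertexGroup.
Variables (K : fieldType) (p : nat).
Hypothesis charK : p \in [pchar K].
Variables (a b : K).
Hypothesis aFp : notin_prime_field a p.
Hypothesis b0 : b != 0.

Let LL := four_skew_lines b aFp.
Let a0 : a != 0 := (notin_prime_field_neq aFp).1.
Let a1 : a - 1 != 0.
Proof. by rewrite subr_eq0 (notin_prime_field_neq aFp).2. Qed.

Let a1' : 1 - a != 0. Proof. by rewrite -opprB oppr_eq0. Qed.

Definition translation (x : 'F_p * 'F_p) : K :=
  x.1%:R * (b / a) + x.2%:R * (b / (a - 1)).

Lemma translationD x y : translation (x + y) = translation x + translation y.
Proof. by rewrite /translation !Fp_natrD // !mulrDl addrACA. Qed.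

Lemma translationB x y : translation (x - y) = translation x - translation y.
Proof. by apply/eqP; rewrite eq_sym subr_eq -translationD subrK. Qed.

Lemma translation0 : translation 0 = 0.
Proof. by rewrite /translation !mul0r addr0. Qed.

(* A relation m / a + n / (a - 1) = 0 reads (m + n) a = m. *)
Lemma translation_inj : injective translation.
Proof.
move=> x y /eqP; rewrite -subr_eq0 -translationB => txy.
apply/eqP; rewrite -subr_eq0; move: (x - y) txy => [m n] {x y}.
rewrite /translation /= => /eqP mn0.
have mna : (m + n)%R%:R * a = m%:R.
  rewrite Fp_natrD //; apply/eqP; rewrite -subr_eq0; apply/eqP.
  apply: (mulfI b0); rewrite mulr0.
  (* Multiplying the relation by a (a - 1) gives b ((m + n) a - m) = 0. *)
  rewrite -[RHS](mul0r (a * (a - 1))) -mn0.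
  by field; rewrite a0 a1.
have [mn|mn] := eqVneq (m + n)%R 0.
  move: mna; rewrite mn mul0r => /esym/eqP; rewrite Fp_natr_eq0 // => /eqP m0.
  by move: mn; rewrite m0 add0r => ->.
(* Here m + n is invertible, so a = m / (m + n) would lie in F_p. *)
have := aFp (m / (m + n))%R.
rewrite Fp_natrM // Fp_natrV // -mna mulrAC mulfV ?mul1r ?eqxx //.
by rewrite Fp_natr_eq0.
Qed.

(** The default branch is meant for L_2 only; on lines outside the configuration the value is
    meaningless. *)
Definition four_frame (L : line K) : K * K * K :=
  if L == L_oo K then (0, 1, 0) else if L == L_0 K then (1, 0, 0)
  else if L == graph_line 1%:M then (1, 1, 0) else (1, a, b).

Let frame_oo : four_frame (L_oo K) = (0, 1, 0).
Proof. by rewrite /four_frame eqxx. Qed.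

Let frame_0 : four_frame (L_0 K) = (1, 0, 0).
Proof.
by rewrite /four_frame eqxx -graph_line0 eq_sym (negPf (skew_neq (skew_oo _))).
Qed.

Let frame_1 : four_frame (graph_line 1%:M) = (1, 1, 0).
Proof.
rewrite /four_frame eqxx eq_sym (negPf (skew_neq (skew_oo _))).
rewrite -graph_line0 (negPf (skew_neq (skew_graph _))) //.
by rewrite subr0 unitmx1.
Qed.

Let frame_M : four_frame (graph_line (M_2 a b)) = (1, a, b).
Proof.
rewrite /four_frame eq_sym (negPf (skew_neq (skew_oo _))).
rewrite -graph_line0 (negPf (skew_neq (skew_graph _))).
  rewrite (negPf (skew_neq (skew_graph _))) //.
  by rewrite M_2B1 unit_tri.
by rewrite subr0 unit_tri.
Qed.

(* Kept opaque: deciding by conversion that two of the lines differ is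
   very slow. *)
Let lines_in : exists t : LL * LL * LL * LL,
  [/\ fsval t.1.1.1 = L_oo K, fsval t.1.1.2 = L_0 K,
      fsval t.1.2 = graph_line 1%:M & fsval t.2 = graph_line (M_2 a b)].
Proof.
have [m1 m2 m3 m4] :=
  mem_fset4 (L_oo K) (L_0 K) (graph_line 1%:M) (graph_line (M_2 a b)).
by exists ([` m1], [` m2], [` m3], [` m4])%fset.
Qed.

Let i_oo := (sval (cid lines_in)).1.1.1.
Let i_0 := (sval (cid lines_in)).1.1.2.
Let i_1 := (sval (cid lines_in)).1.2.
Let i_M := (sval (cid lines_in)).2.

Let four_cases (i : LL) : [\/ i = i_oo, i = i_0, i = i_1 | i = i_M].
Proof.
have [e1 e2 e3 e4] := svalP (cid lines_in).
case: (in_fset4P (fsvalP i : fsval i \in four_lines a b)) => iE;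
  [apply: Or41 | apply: Or42 | apply: Or43 | apply: Or44]; apply: val_inj.
- by rewrite /= e1.
- by rewrite /= e2.
- by rewrite /= e3.
- by rewrite /= e4.
Qed.

Definition frame (i : LL) := four_frame (fsval i).

Let frameE : (frame i_oo = (0, 1, 0)) * (frame i_0 = (1, 0, 0)) *
  (frame i_1 = (1, 1, 0)) * (frame i_M = (1, a, b)).
Proof.
have [e1 e2 e3 e4] := svalP (cid lines_in).
by rewrite /frame e1 e2 e3 e4 frame_oo frame_0 frame_1 frame_M.
Qed.

Lemma frameP (i : LL) : frames (frame i) (fsval i).
Proof.
have [e1 e2 e3 e4] := svalP (cid lines_in).
case: (four_cases i) => ->; rewrite frameE ?(e1, e2, e3, e4).
- exact: frames_oo.
- have <- : graph_line (tri 0 0) = L_0 K.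
    by rewrite tri_scalar raddf0 graph_line0.
  exact: frames_graph.
- rewrite -tri_scalar; exact: frames_graph.
- rewrite M_2_tri; exact: frames_graph.
Qed.

Let t1 : translation (1, 0) = b / a.
Proof. by rewrite /translation /= mul0r addr0 mul1r. Qed.

Let t2 : translation (0, 1) = b / (a - 1).
Proof. by rewrite /translation /= mul0r add0r mul1r. Qed.

Lemma cross_slope (i k : LL) : i != k ->
  cross (frame i) (frame k) != 0 /\
  exists x, slope (frame i) (frame k) = translation x.
Proof.
rewrite /slope /crossE /cross.
case: (four_cases i) => ->; case: (four_cases k) => ->; rewrite ?eqxx //= => _;
  rewrite !frameE /=;
  rewrite ?(mulr0, mul0r, mulr1, mul1r, subr0, sub0r, oppr_eq0, oner_eq0);
  rewrite ?(a0, a1, a1') //; split=> //.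
(* [cross] and [crossE] are both antisymmetric, so the slope does not depend on the order of the
   lines. It is b / a for L_0 and L_2, b / (a - 1) for L_1 and L_2, and 0 otherwise. *)
all: try by exists 0; rewrite ?oppr0 ?mul0r translation0.
all: try by exists (1, 0); rewrite ?invrN ?mulrNN t1.
all: by exists (0, 1); rewrite -?[1 - a]opprB ?invrN ?mulrNN t2.
Qed.

Definition shears (i j : LL) (t : K)
    (f : Defs.point (fsval i) -> Defs.point (fsval j)) : Prop :=
  forall (P : Defs.point (fsval i)) v, frame_pt (frame i) v \in point_vs P ->
    frame_pt (frame j) (tri 1 t *m v) \in point_vs (f P).

Lemma shears_id (i : LL) : @shears i i 0 id.
Proof. by move=> P v; rewrite tri_scalar mul1mx. Qed.

Lemma shears_comp (i j k : LL) s t f g :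
  @shears i j s f -> @shears j k t g -> @shears i k (s + t) (g \o f).
Proof.
move=> fs gt P v /fs/gt; rewrite tri_mul.
by rewrite !mul1r mulr1.
Qed.

Lemma shears_proj (i j k : LL) (ik : i != k) (jk : j != k) :
  @shears i j (slope (frame i) (frame k) - slope (frame j) (frame k))
    (proj (skew_of ik) (skew_of jk)).
Proof.
move=> P v; apply: proj_frame; [exact: frameP | exact: frameP | |].
  exact: (cross_slope ik).1.
exact: (cross_slope jk).1.
Qed.

(** A point is spanned by any nonzero vector in it, and [tri 1 t], with inverse [tri 1 (- t)], keeps
    vectors nonzero. *)
Lemma shears_inj (i j : LL) t f g : @shears i j t f -> shears t g -> f = g.
Proof.
move=> ft gt; apply/funext => P; apply: point_inj.
have [v v0 Pv] := frame_pt_in_point (frameP i) P.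
have w0 : frame_pt (frame j) (tri 1 t *m v) != 0.
  apply: contra_neq v0.
  move=> /(frame_pt_eq0 (frameP j))/(congr1 (mulmx (tri 1 (- t)))).
  by rewrite tri_mul mulr1 !mul1r mulr1 subrr tri_scalar mul1mx mulmx0.
by rewrite (point_vline (ft _ _ Pv) w0) (point_vline (gt _ _ Pv) w0).
Qed.

Lemma shears_uniq (i j : LL) s t f : @shears i j s f -> shears t f -> s = t.
Proof.
(* The second basis vector is sent to (t, 1): its last coordinate forces the proportionality factor
   to be 1, and the first then reads off t. *)
move=> fs ft; pose v : 'cV[K]_2 := \col_k (k == 1)%:R.
have triv r k : (tri 1 r *m v) k 0 = if k == 0 then r else 1.
  rewrite !mxE !big_ord_recl big_ord0 !mxE.
  by case: k => [[|[|k]] ?] //; rewrite -?val_eqE /= ?mulr0 ?mulr1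
    ?mulr1n ?mulr0n ?addr0 ?add0r.
have v0 : v != 0.
  by apply/eqP => /matrixP/(_ 1 0)/eqP; rewrite !mxE oner_eq0.
have [P Pv] := point_of_frame (frameP i) v0.
have w0 : frame_pt (frame j) (tri 1 s *m v) != 0.
  apply/eqP => /(frame_pt_eq0 (frameP j))/matrixP/(_ 1 0)/eqP.
  by rewrite triv mxE oner_eq0.
have := ft _ _ Pv; rewrite (point_vline (fs _ _ Pv) w0) => /vlineP[c].
rewrite -linearZ => /eqP; rewrite -subr_eq0 -linearB => /eqP.
move=> /(frame_pt_eq0 (frameP j))/eqP; rewrite subr_eq0 => /eqP/matrixP E.
have := E 1 0; have := E 0 0; rewrite !(triv, mxE) /= => ->.
by rewrite mulr1 => <-; rewrite mul1r.
Qed.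

Lemma arrow_shears (i j : LL) f :
  @arrow _ LL i j f -> exists x, shears (translation x) f.
Proof.
elim=> {i j f} [i j k ij ik jk|i|i j k f g _ [x fx] _ [y gy]].
- have [_ [x xE]] := cross_slope ik; have [_ [y yE]] := cross_slope jk.
  by exists (x - y); rewrite translationB -xE -yE; apply: shears_proj.
- by exists 0; rewrite translation0; apply: shears_id.
- by exists (x + y); rewrite translationD; apply: shears_comp fx gy.
Qed.

(** * Realising every translation by a loop *)

Definition reach (i j : LL) t := exists2 f, @arrow _ LL i j f & shears t f.

Lemma reach_comp (j i k : LL) s t :
  reach i j s -> reach j k t -> reach i k (s + t).
Proof.
move=> [f af fs] [g ag gt]; exists (g \o f); first exact: arrow_comp ag.
exact: shears_comp gt.
Qed.

Lemma reach_id (i : LL) : reach i i 0.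
Proof. by exists id; [apply: arrow_id | apply: shears_id]. Qed.

Lemma reach_proj (k i j : LL) : i != j -> i != k -> j != k ->
  reach i j (slope (frame i) (frame k) - slope (frame j) (frame k)).
Proof.
move=> ij ik jk; exists (proj (skew_of ik) (skew_of jk)).
  exact: arrow_proj.
exact: shears_proj.
Qed.

Let neq (i j : LL) : frame i != frame j -> i != j.
Proof. exact/contra_neq/congr1. Qed.

Let neqC (i j : LL) : i != j -> j != i.
Proof. by rewrite eq_sym. Qed.

Let distinct :
  [/\ i_oo != i_0, i_oo != i_1, i_oo != i_M &
     [/\ i_0 != i_1, i_0 != i_M & i_1 != i_M]].
Proof.
have [a_0 a_1] := notin_prime_field_neq aFp.
split; last split; apply: neq;
  rewrite !frameE !xpair_eqE ?[0 == 1]eq_sym ?oner_eq0 //;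
  by rewrite ?[_ == a]eq_sym ?(negPf a_0) ?(negPf a_1) ?andbF.
Qed.

Let slope_oo (i : LL) :
  slope (frame i_oo) (frame i) = 0 /\ slope (frame i) (frame i_oo) = 0.
Proof. by rewrite /slope /crossE frameE /= !(mulr0, mul0r) subrr !mul0r. Qed.

Let slope_01 :
  slope (frame i_0) (frame i_1) = 0 /\ slope (frame i_1) (frame i_0) = 0.
Proof. by rewrite /slope /crossE !frameE /= !(mulr0, mul0r) subrr !mul0r. Qed.

Let slope_M :
  slope (frame i_0) (frame i_M) = b / a /\
  slope (frame i_1) (frame i_M) = b / (a - 1).
Proof.
by rewrite /slope /crossE /cross !frameE /= !(mulr0, mulr1) !subr0.
Qed.

(** Projections from L_oo have shear 0, as all slopes with L_oo vanish; between L_oo and L_0 the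
    centre L_1 serves, its slopes with both being 0. *)
Let reach_0 (i : LL) : reach i i_0 0 /\ reach i_0 i 0.
Proof.
have [oo0 oo1 ooM [n01 n0M n1M]] := distinct.
have [s01 s10] := slope_01.
have via_oo j : i_oo != j -> i_0 != j -> reach j i_0 0 /\ reach i_0 j 0.
  move=> ooj n0j; split.
    have := reach_proj (neqC n0j) (neqC ooj) (neqC oo0).
    by rewrite !(slope_oo _).2 subrr.
  have := reach_proj n0j (neqC oo0) (neqC ooj).
  by rewrite !(slope_oo _).2 subrr.
case: (four_cases i) => ->.
- split.
    by have := reach_proj oo0 oo1 n01; rewrite (slope_oo _).1 s01 subrr.
  by have := reach_proj (neqC oo0) n01 oo1; rewrite (slope_oo _).1 s01 subrr.
- by split; apply: reach_id.
- exact: via_oo oo1 n01.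
- exact: via_oo ooM n0M.
Qed.

Let reach_muln (i : LL) t n : reach i i t -> reach i i (t *+ n).
Proof.
move=> it; elim: n => [|n IHn]; last by rewrite mulrS; apply: reach_comp IHn.
exact: reach_id.
Qed.

(* b / a is the shear of the loop L_0 -> L_oo -> L_0 going out by projection
   from L_2 and back by projection from L_1; b / (a - 1) is that of the loop
   L_1 -> L_oo -> L_1 going out from L_2 and back from L_0. *)
Lemma reach_translation (i : LL) x : reach i i (translation x).
Proof.
have [oo0 oo1 ooM [n01 n0M n1M]] := distinct.
have [s01 s10] := slope_01; have [s0M s1M] := slope_M.
have loop0 : reach i_0 i_0 (b / a).
  have to_oo := reach_proj (neqC oo0) n0M ooM.
  have from_oo := reach_proj oo0 oo1 n01.
  move: (reach_comp to_oo from_oo).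
  by rewrite s0M !(slope_oo _).1 s01 !subr0 addr0.
have loop1 : reach i_1 i_1 (b / (a - 1)).
  have to_oo := reach_proj (neqC oo1) n1M ooM.
  have from_oo := reach_proj oo1 oo0 (neqC n01).
  move: (reach_comp to_oo from_oo).
  by rewrite s1M !(slope_oo _).1 s10 !subr0 addr0.
(* Conjugation by paths of shear 0 through L_0 moves a loop to any vertex without changing its
   shear. *)
have conj j k t : reach j j t -> reach k k t.
  have [k0 _0k] := reach_0 k; have [j0 _0j] := reach_0 j.
  move=> jt; have :=
    reach_comp (reach_comp k0 _0j) (reach_comp jt (reach_comp j0 _0k)).
  by rewrite !addr0 !add0r.
(* Coefficients in F_p act as natural multiples, that is, as iterated loops. *)
rewrite /translation !mulr_natl.
by apply: reach_comp; apply: reach_muln;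
  [apply: conj loop0 | apply: conj loop1].
Qed.

Lemma vertex_group_iso (i : LL) :
  group_iso (vertex_group i) ('F_p * 'F_p)%type.
Proof.
apply: (@group_iso_of_rel _ _
  (fun (f : vertex_group i) (x : 'F_p * 'F_p) => shears (translation x) f)).
- by move=> f; apply: arrow_shears; apply: asboolW (vg_arrow f).
- by move=> x; have [f af fx] := reach_translation i x;
    exists (VertexGroup (asboolT af)).
- by move=> f x y fx fy; apply/translation_inj/(shears_uniq fx fy).
- by move=> f g x fx gx; apply/vgP/(shears_inj fx gx).
(* The product of [f] and [g] applies [g] first, so the shears add in the opposite order. *)
- move=> f g x y fx gy; rewrite [translation _]translationD addrC.
  exact: shears_comp gy fx.
Qed.
End VertexGroup.

(** * Cardinality, and the structure of the group *)

Lemma card_eq_bijective (T : finType) (U : Type) (f : U -> T) :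
  bijective f -> ([set: U]%classic #= `I_#|T|%classic)%card.
Proof.
move=> [g fK gK]; pose h (k : 'I_#|T|) := g (enum_val k).
have -> : [set: U]%classic = (h @` setT)%classic.
  apply/seteqP; split=> // u _; exists (enum_rank (f u)) => //.
  by rewrite /h enum_rankK fK.
apply: card_eq_trans (card_esym card_II); apply: inj_card_eq => k l _ _.
by move=> /(can_inj gK)/enum_val_inj.
Qed.

Local Close Scope ring_scope.

Theorem proposition3p9 (K : closedFieldType) (p : nat)
    (charK : p \in [pchar K]%R) (a b : K)
    (aFp : notin_prime_field a p) (b0 : b != 0%R)
    (i : four_skew_lines b aFp) :
  let G : groupType := vertex_group i in
  [/\ forall f g : G, commute f g,
      ([set: G]%classic #= `I_(p ^ 2)%classic)%card,
      group_iso G ('F_p * 'F_p)%type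
    & forall C : finGroupType, cyclic [set: C] -> #|C| = p ->
        group_iso G (C * C)%type].
Proof.
move=> G; have p_pr : prime p := pcharf_prime charK.
have isoG : group_iso G ('F_p * 'F_p)%type by apply: vertex_group_iso.
split=> //; last first.
- move=> C cycC cardC.
  exact: group_iso_trans isoG (group_iso_Fp2_cyclic p_pr cycC cardC).
- have [f bf] := isoG; have := card_eq_bijective bf.
  by rewrite card_prod !card_Fp // mulnn.
(* Commutativity is pulled back along the isomorphism from addition in F_p x F_p. *)
- have [f bf] := isoG; move=> g h; apply: (bij_inj bf).
  by rewrite !gmulfM; apply: (@addrC ('F_p * 'F_p)%type).
Qed.
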